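(* Let $n\geq 1$ and let $D$ be a locally countable Borel directed graph with finite Borel chromatic number $\chi_B(\tilde{D})<\infty$ in which every vertex has out-degree at most $n$. Then there is a Borel set $M\subseteq V(D)$ such that $\chi_B(\tilde{D}[M])\leq n+1$ and $\rho(x,M)\leq 1$ for all $x\in V(D)$.
   Context: A directed graph $D$ consists of a vertex set $V(D)$ and an irreflexive relation $A(D)\subseteq V(D)\times V(D)$ of arcs; it is a Borel directed graph if $V(D)$ is a standard Borel space and $A(D)$ is Borel. The out-degree of $x$ is the number of $y$ with $(x,y)\in A(D)$. The underlying graph $\tilde{D}$ has $x,y$ adjacent iff $(x,y)\in A(D)$ or $(y,x)\in A(D)$; $\tilde{D}[M]$ denotes the induced subgraph on $M$. $D$ is locally countable if every vertex has countably many neighbours in $\tilde{D}$. The Borel chromatic number $\chi_B$ of a graph is the least $k$ admitting a Borel proper coloring with $k$ colors ($\infty$ if none). The directed distance $\rho(x,y)$ in $D$ is the minimal length of a directed path from $x$ to $y$ (with $\rho(x,x)=0$, $\infty$ if no path), and $\rho(x,M)=\inf_{y\in M}\rho(x,y)$. *)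

(* Defs.v *)
From mathcomp Require Export all_boot all_order all_algebra.
From mathcomp Require Export all_classical all_reals all_analysis.

Set Implicit Arguments.
Unset Strict Implicit.
Unset Printing Implicit Defensive.

Import Order.TTheory GRing.Theory Num.Theory.
Local Open Scope classical_set_scope.
Local Open Scope ring_scope.

Definition complete_metric (R : realType) (P : metricType R) : Prop :=
  forall F : set_system P, ProperFilter F -> cauchy F -> exists l : P, F --> l.

Definition separable_space (P : topologicalType) : Prop :=
  exists2 S : set P, countable S & dense S.

(* A measurable space isomorphic to a Polish space with its Borel sets. *)
Definition standard_borel (R : realType) (d : measure_display)
    (T : measurableType d) : Prop :=
  exists P : metricType R, [/\ complete_metric P, separable_space P &
    exists2 f : T -> P, bijective f &
      forall B : set P, <<s [set U : set P | open U] >> B <->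
                        measurable (f @^-1` B)].

Section digraph.
Context (d : measure_display) (V : measurableType d).
Implicit Types (A : set (V * V)) (G : V -> V -> Prop) (M : set V).

Definition out_neighbours A (x : V) : set V := [set y | A (x, y)].

Definition underlying A (x y : V) : Prop := A (x, y) \/ A (y, x).

Definition locally_countable A : Prop :=
  forall x, countable [set y | underlying A x y].

(* Borel proper k-colorings of the induced subgraph G[M]; the values of c
   outside M are irrelevant. To be used with M measurable, since
   [measurable_fun M c] holds vacuously otherwise. *)
Definition borel_colorable G M (k : nat) : Prop :=
  exists c : V -> nat,
    [/\ measurable_fun M c,
        forall x, M x -> (c x < k)%N &
        forall x y, M x -> M y -> G x y -> c x <> c y].

(* The Borel chromatic number of G[M]; the infimum of the empty set is +oo. *)
Definition borel_chromatic (R : realType) G M : \bar R :=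
  ereal_inf [set (k%:R)%:E | k in borel_colorable G M].

Definition directed_path A (x y : V) (p : seq V) : Prop :=
  [/\ path (fun u v => `[< A (u, v) >]) x p, uniq (x :: p) & last x p = y].

Definition ddist (R : realType) A (x y : V) : \bar R :=
  ereal_inf [set ((size p)%:R)%:E | p in directed_path A x y].

Definition ddist_set (R : realType) A (x : V) M : \bar R :=
  ereal_inf [set ddist R A x y | y in M].

End digraph.

(* Main.v *)
Require Import Defs.
From mathcomp Require Import lra.

Set Implicit Arguments.
Unset Strict Implicit.
Unset Printing Implicit Defensive.

Import Order.TTheory GRing.Theory Num.Theory.
Local Open Scope classical_set_scope.
Local Open Scope ring_scope.

(** Let [c] be a Borel proper coloring with finitely many colors. Going through
    the colors in increasing order, put into [M] every vertex of the current
    color that has no out-neighbour in [M] yet. Every vertex outside [M] then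
    has an out-neighbour in [M], and [c] strictly increases along the arcs
    inside [M]; hence coloring [M] greedily, by decreasing [c], only has to
    avoid the at most [n] colors of the out-neighbours.

    This is Borel as soon as the set of vertices having an out-neighbour in a
    Borel set is Borel, that is, as soon as projections of Borel sets with
    sections of at most [n] points are Borel. A standard Borel space is a Borel
    retract of the Baire space, so it suffices to prove that for the Baire
    space. There the points whose section meets [n] given disjoint cylinders
    have exactly one section point in each cylinder; the coordinates of these
    points are Borel functions by Lusin's separation theorem, so the set of
    such points is Borel. Removing all of these sets lowers [n]. *)

(** * Analytic sets of the Baire space *)

Section baire_topology.
Implicit Types (x y : nat -> nat) (s : seq nat) (F S T : set (nat -> nat)).

Definition agree n x y := forall i, (i < n)%N -> x i = y i.

(** Closedness for the product of discrete topologies, phrased with finite prefixes: [F] contains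
    every branch all of whose prefixes extend to points of [F]. *)
Definition baire_closed F :=
  forall x, (forall n, exists2 y, F y & agree n x y) -> F x.

Definition baire_continuous (g : (nat -> nat) -> nat -> nat) :=
  forall m x, exists n, forall y, agree n x y -> g y m = g x m.

Definition cylinder s : set (nat -> nat) := [set x | mkseq x (size s) = s].

Lemma agree_le m n x y : (m <= n)%N -> agree n x y -> agree m x y.
Proof. by move=> mn xy i im; apply: xy; apply: leq_trans mn. Qed.

Lemma agree_mkseq n x y : mkseq x n = mkseq y n <-> agree n x y.
Proof.
split=> [xy i ni|xy].
  by rewrite -(nth_mkseq 0%N x ni) xy nth_mkseq.
apply: (@eq_from_nth _ 0%N); rewrite !size_mkseq // => i ni.
by rewrite !nth_mkseq //; apply: xy.
Qed.

Lemma cylinder_mkseq n x y : cylinder (mkseq x n) y <-> agree n x y.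
Proof.
by rewrite /cylinder /= size_mkseq; split=> [xy|/agree_mkseq->//];
  apply/agree_mkseq.
Qed.

Lemma baire_continuous_agree g n x : baire_continuous g ->
  exists k, forall y, agree k x y -> agree n (g x) (g y).
Proof.
move=> cg; elim: n => [|n [k IH]]; first by exists 0%N => y _ i.
have [l Hl] := cg n x; exists (maxn k l) => y xy i; rewrite ltnS leq_eqVlt.
case/orP => [/eqP ->|ilt].
  by rewrite Hl //; apply: agree_le xy; rewrite leq_maxr.
by apply: IH ilt; apply: agree_le xy; rewrite leq_maxl.
Qed.

Lemma baire_continuous_id : baire_continuous id.
Proof. by move=> m x; exists m.+1 => y /(_ m (ltnSn m)) ->. Qed.

Lemma baire_continuous_comp g h : baire_continuous g -> baire_continuous h ->
  baire_continuous (g \o h).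
Proof.
move=> cg ch m x; have [n Hn] := cg m (h x).
have [k Hk] := baire_continuous_agree n x ch.
by exists k => y /Hk /Hn.
Qed.

Lemma baire_closed_preimage g F : baire_continuous g -> baire_closed F ->
  baire_closed (g @^-1` F).
Proof.
move=> cg cF x xF; apply: cF => n.
have [k Hk] := baire_continuous_agree n x cg.
by have [y Fy /Hk xy] := xF k; exists (g y).
Qed.

Lemma baire_closed_equalizer g h : baire_continuous g -> baire_continuous h ->
  baire_closed [set x | g x = h x].
Proof.
move=> cg ch x xF; apply/funext => m.
have [n Hn] := cg m x; have [k Hk] := ch m x.
have [y gh xy] := xF (maxn n k).
rewrite -(Hn y) ?gh ?(Hk y) //; apply: agree_le xy;
  by rewrite ?leq_maxl ?leq_maxr.
Qed.

Lemma baire_closedI F T : baire_closed F -> baire_closed T ->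
  baire_closed (F `&` T).
Proof.
move=> cF cT x xFT; split; [apply: cF|apply: cT] => n;
  by have [y [Fy Ty] xy] := xFT n; exists y.
Qed.

Lemma baire_closed_bigcap (F : nat -> set (nat -> nat)) :
  (forall n, baire_closed (F n)) -> baire_closed (\bigcap_n F n).
Proof.
by move=> cF x xF n _; apply: cF => k; have [y Fy xy] := xF k; exists y => //;
  apply: Fy.
Qed.

Lemma baire_closed_coord m (P : set nat) : baire_closed [set x | P (x m)].
Proof.
by move=> x /(_ m.+1) [y /= Py xy]; rewrite /= xy.
Qed.

(** Through the pairing of [nat * nat] with [nat], one point codes a whole sequence of points. *)
Definition column (n : nat) x : nat -> nat := fun i => x (pickle (n, i)).

Definition merge_columns (x_ : nat -> nat -> nat) : nat -> nat := fun k =>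
  if (unpickle k : option (nat * nat)) is Some (n, i) then x_ n i else 0%N.

Lemma column_merge n (x_ : nat -> nat -> nat) : column n (merge_columns x_) = x_ n.
Proof. by apply/funext => i; rewrite /column /merge_columns pickleK. Qed.

Lemma column_continuous n : baire_continuous (column n).
Proof. by move=> m x; exists (pickle (n, m)).+1 => y /(_ _ (ltnSn _)). Qed.

(** Letting the domain be any closed set, not the whole space, includes the empty set without a
    separate clause. *)
Definition analytic S := exists F g,
  [/\ baire_closed F, baire_continuous g & S = g @` F].

Lemma closed_analytic F : baire_closed F -> analytic F.
Proof.
by move=> cF; exists F, id; split; rewrite ?image_id //; apply: baire_continuous_id.
Qed.

Lemma image_analytic g S : baire_continuous g -> analytic S -> analytic (g @` S).
Proof.
move=> cg [F [h [cF ch ->]]]; exists F, (g \o h); split => //.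
  exact: baire_continuous_comp.
by rewrite image_comp.
Qed.

(** A point of the intersection is coded by one preimage per column; requiring all images to agree
    with that of column 0 is a closed condition. *)
Lemma bigcap_analytic (S_ : nat -> set (nat -> nat)) :
  (forall n, analytic (S_ n)) -> analytic (\bigcap_n S_ n).
Proof.
move=> /choice[F_ /choice[g_ Hg]].
exists (\bigcap_n ([set x | F_ n (column n x)] `&`
  [set x | g_ n (column n x) = g_ 0%N (column 0 x)])), (g_ 0%N \o column 0); split.
- apply: baire_closed_bigcap => n; apply: baire_closedI.
    by apply: baire_closed_preimage; [exact: column_continuous|case: (Hg n)].
  by apply: (@baire_closed_equalizer (g_ n \o column n) (g_ 0%N \o column 0));
    apply: baire_continuous_comp (@column_continuous _); case: (Hg n);
    case: (Hg 0%N).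
- by apply: baire_continuous_comp (@column_continuous _); case: (Hg 0%N).
- apply/seteqP; split=> [x Sx|_ [x Fx <-]] /=.
    have : forall n, exists y, F_ n y /\ g_ n y = x.
      by move=> n; have := Sx n I; case: (Hg n) => _ _ -> [y Fy <-]; exists y.
    move=> /choice[y_ Hy]; exists (merge_columns y_).
      move=> n _; split=> /=; rewrite !column_merge; first by case: (Hy n).
      by rewrite (Hy n).2 (Hy 0%N).2.
    by rewrite column_merge (Hy 0%N).2.
  move=> n _; case: (Hg n) => _ _ ->; have [/= Fn <-] := Fx n I.
  by exists (column n x).
Qed.

(** The first entry of a code selects the set, and its tail is a preimage for that set. *)
Lemma bigcup_analytic (S_ : nat -> set (nat -> nat)) :
  (forall n, analytic (S_ n)) -> analytic (\bigcup_n S_ n).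
Proof.
move=> /choice[F_ /choice[g_ Hg]].
have shift_agree n x y : agree n.+1 x y -> agree n (x \o succn) (y \o succn).
  by move=> xy i ni; apply: xy.
exists [set x | F_ (x 0%N) (x \o succn)], (fun x => g_ (x 0%N) (x \o succn)).
split.
- move=> x xF /=; have [cF _ _] := Hg (x 0%N); apply: cF => n.
  have [y Fy xy] := xF n.+1; exists (y \o succn); last exact: shift_agree.
  by rewrite (xy 0%N).
- move=> m x; have [_ cg _] := Hg (x 0%N); have [n Hn] := cg m (x \o succn).
  by exists n.+1 => y xy; rewrite -(xy 0%N) // Hn //; apply: shift_agree.
- apply/seteqP; split=> [x [n _]|_ [x Fx <-]].
    have [_ _ ->] := Hg n => -[y Fy <-].
    by exists (fun k => if k is k'.+1 then y k' else n).
  by exists (x 0%N) => //; have [_ _ ->] := Hg (x 0%N); exists (x \o succn).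
Qed.

Lemma setI_analytic S T : analytic S -> analytic T -> analytic (S `&` T).
Proof.
move=> aS aT; rewrite -bigcap2E; apply: bigcap_analytic => -[//|[//|n]] /=.
by apply: closed_analytic.
Qed.

End baire_topology.

(** * Borel sets of the Baire space *)

Definition coordinate_cylinders : set (set (nat -> nat)) :=
  [set C | exists m a, C = [set x | x m = a]].

Notation baire := (g_sigma_algebraType coordinate_cylinders).

Lemma measurable_coord m (P : set nat) : measurable [set x : baire | P (x m)].
Proof.
rewrite (_ : [set x : baire | P (x m)] =
  \bigcup_(a in P) [set x : baire | x m = a]); last first.
  by apply/seteqP; split=> [x Px|x [a Pa]]; [exists (x m)|move=> /= ->].
apply: bigcup_measurable => a _; apply: sub_sigma_algebra.
by exists m, a.
Qed.

Lemma measurable_cylinder s : measurable (cylinder s : set baire).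
Proof.
have -> : cylinder s = \bigcap_(i in [set i | (i < size s)%N])
    [set x : baire | x i = nth 0%N s i].
  apply/seteqP; split=> [x sx i /= si|x sx].
    by rewrite -[in RHS]sx nth_mkseq.
  apply: (@eq_from_nth _ 0%N); rewrite size_mkseq // => i si.
  by rewrite nth_mkseq //; exact: sx.
apply: bigcap_measurableType => i _.
exact: (@measurable_coord i [set a | a = nth 0%N s i]).
Qed.

Lemma measurable_fun_baire d (T : measurableType d) (f : T -> baire) :
  (forall m a, measurable [set t | f t m = a]) -> measurable_fun setT f.
Proof.
move=> mf; apply: (@measurability _ _ T baire setT f coordinate_cylinders) => //.
by move=> _ [_ [m [a ->]] <-]; rewrite setTI; exact: mf.
Qed.

(** Analytic sets need not be closed under complement, so the induction carries the complement
    along: the sets that are analytic together with their complements form a sigma-algebra. *)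
Lemma measurable_analytic (B : set baire) : measurable B -> analytic B.
Proof.
suff H : coordinate_cylinders.-sigma.-measurable `<=`
    [set B | analytic B /\ analytic (~` B)] by move=> /H[].
apply: smallest_sub.
  split.
  - by rewrite /= setC0; split; apply: closed_analytic => // x /(_ 0%N)[].
  - by move=> C [aC aCc] /=; rewrite setTD setCK.
  - move=> C aC /=; split; first by apply: bigcup_analytic => n; case: (aC n).
    by rewrite setC_bigcup; apply: bigcap_analytic => n; case: (aC n).
move=> _ [m [a ->]]; split; apply: closed_analytic.
  exact: (@baire_closed_coord m [set b | b = a]).
exact: (@baire_closed_coord m [set b | b <> a]).
Qed.

(** * Lusin's separation theorem *)

Definition borel_separated (S T : set baire) :=
  exists B : set baire, [/\ measurable B, S `<=` B & B `&` T = set0].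

Lemma borel_separated_bigcup (S T : nat -> set baire) :
  (forall i j, borel_separated (S i) (T j)) ->
  borel_separated (\bigcup_i S i) (\bigcup_j T j).
Proof.
move=> sST; have /choice[B HB] : forall i, exists B : nat -> set baire, forall j,
    [/\ measurable (B j), S i `<=` B j & B j `&` T j = set0].
  by move=> i; have /choice[B HB] := sST i; exists B.
exists (\bigcup_i \bigcap_j B i j); split.
- apply: bigcupT_measurable => i; apply: bigcap_measurableType => j _.
  by case: (HB i j).
- by move=> x [i _ Six]; exists i => // j _; case: (HB i j) => _ + _; apply.
- rewrite -subset0 => x [[i _ Bx] [j _ Tx]].
  by have [_ _ <-] := HB i j; split => //; exact: Bx.
Qed.

(* If the two images were not separated, some pair of branches would keep all
   restrictions to its cylinders unseparated; yet the two images of that pair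
   differ at a coordinate, and continuity makes that coordinate constant on
   small enough cylinders. *)
Theorem analytic_separation (S T : set baire) :
  analytic S -> analytic T -> S `&` T = set0 -> borel_separated S T.
Proof.
move=> [F [g [cF cg ->]]] [G [h [cG ch ->]]] disj.
pose bad (p : seq nat * seq nat) := ~ borel_separated
  (g @` (F `&` cylinder p.1)) (h @` (G `&` cylinder p.2)).
have cylinder_rcons (s : seq nat) : cylinder s = \bigcup_a cylinder (rcons s a).
  apply/seteqP; split=> [x sx|x [a _]]; rewrite /cylinder /=.
    by exists (x (size s)) => //=; rewrite size_rcons mkseqS sx.
  by rewrite size_rcons mkseqS => /rcons_inj[].
have image_rcons k (E : set (nat -> nat)) s :
    k @` (E `&` cylinder s) = \bigcup_a k @` (E `&` cylinder (rcons s a)).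
  by rewrite [in LHS]cylinder_rcons setI_bigcupr image_bigcup.
(* With the hypothesis [bad p] under the existential, choice gives a total [next]; its value at
   pairs that are not bad is irrelevant. *)
have bad_step p : exists ab : nat * nat,
    bad p -> bad (rcons p.1 ab.1, rcons p.2 ab.2).
  have [badp|] := pselect (bad p); last by exists (0, 0)%N.
  apply: contrapT => noext; apply: badp.
  rewrite (image_rcons _ g) (image_rcons _ h); apply: borel_separated_bigcup => a b.
  by apply: contrapT => nsep; apply: noext; exists (a, b).
have [next Hnext] := choice bad_step.
apply: contrapT => nsep.
pose st := fix st n : seq nat * seq nat := if n is n'.+1 then
  let p := st n' in (rcons p.1 (next p).1, rcons p.2 (next p).2) else ([::], [::]).
have bad_st n : bad (st n).
  elim: n => [|n IH] /=; last exact: Hnext.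
  have cyl0 : cylinder [::] = setT by apply/seteqP.
  by rewrite /bad /= cyl0 !setIT.
pose x n := (next (st n)).1; pose y n := (next (st n)).2.
have stE n : st n = (mkseq x n, mkseq y n).
  by elim: n => [//|n IH]; rewrite !mkseqS /= IH /= /x /y IH.
(* If no point of [F] shared some prefix of [x], the first image would be empty there and [set0]
   would separate; for [y] below, [setT] does. *)
have Fx : F x.
  apply: cF => n; apply: contrapT => noF; apply: (bad_st n).
  exists set0; split=> //; rewrite ?set0I // stE /= => _ [z [Fz zx] <-].
  by apply: noF; exists z => //; apply/cylinder_mkseq.
have Gy : G y.
  apply: cG => n; apply: contrapT => noG; apply: (bad_st n).
  exists setT; split=> //; rewrite setTI -subset0 stE /= => _ [z [Gz zy] <-].
  by apply: noG; exists z => //; apply/cylinder_mkseq.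
have [m gxhy] : exists m, g x m <> h y m.
  apply: contrapT => /forallNP gh; have : set0 (g x); last by [].
  rewrite -disj; split; [by exists x|exists y => //].
  by apply/funext => m; have /contrapT-> := gh m.
have [k Hk] := cg m x; have [l Hl] := ch m y.
apply: (bad_st (maxn k l)); exists [set z : baire | z m = g x m]; split.
- exact: (@measurable_coord m [set a | a = g x m]).
- rewrite stE => _ [z [Fz /cylinder_mkseq xz] <-] /=.
  by apply: Hk; apply: agree_le xz; rewrite leq_maxl.
- rewrite stE -subset0 => w [/= wg [z [Gz /cylinder_mkseq yz] zw]].
  apply: gxhy; rewrite -wg -zw; apply: Hl.
  by apply: agree_le yz; rewrite leq_maxr.
Qed.

(** * Projections of Borel sets with small sections *)

(** Least element, made total by the value 0 on the empty set; it serves as a Borel selector. *)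
Definition first_index (P : set nat) : nat :=
  xget 0%N [set a | P a /\ forall b, (b < a)%N -> ~ P b].

Lemma first_index_eq (P : set nat) a :
  P a -> (forall b, (b < a)%N -> ~ P b) -> first_index P = a.
Proof.
move=> Pa minPa; apply: xget_unique => // b [Pb minPb].
by case: (ltngtP a b) => // [/minPb|/minPa].
Qed.

Lemma first_indexP (P : set nat) : P !=set0 ->
  P (first_index P) /\ forall b, (b < first_index P)%N -> ~ P b.
Proof.
move=> [a0 Pa0]; have exP : exists a, `[< P a >] by exists a0; apply/asboolP.
case: (ex_minnP exP) => a /asboolP Pa mina.
have minPa b : (b < a)%N -> ~ P b.
  by move=> ba /asboolP/mina; rewrite leqNgt ba.
by rewrite (first_index_eq Pa minPa).
Qed.

Lemma first_index_set0 : first_index set0 = 0%N.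
Proof. by rewrite /first_index; case: xgetP => // a _ []. Qed.

Lemma measurable_first_index d (T : measurableType d) (S : nat -> set T) a :
  (forall b, measurable (S b)) ->
  measurable [set t | first_index [set b | S b t] = a].
Proof.
move=> mS.
pose first := S a `\` \bigcup_(b in [set b | (b < a)%N]) S b.
(* The default value of [first_index] adds to the fibre over 0 the points lying in no [S b]. *)
pose none := if a == 0%N then ~` \bigcup_b S b else set0.
have -> : [set t | first_index [set b | S b t] = a] = first `|` none.
  apply/seteqP; split=> t /=.
    have [[b Sb]|noS] := pselect (exists b, S b t).
      have [Sf minf] := first_indexP (ex_intro _ b Sb : [set b | S b t] !=set0).
      by move=> fa; left; rewrite /first -fa; split => // -[c /= /minf].
    have S0 : [set b | S b t] = set0.
      by rewrite -subset0 => b Sb; apply: noS; exists b.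
    rewrite S0 first_index_set0 => a0; right; rewrite /none -a0 eqxx => -[b _ Sb].
    by apply: noS; exists b.
  case=> [[Sa minS]|].
    by apply: first_index_eq => // b ba Sb; apply: minS; exists b.
  rewrite /none; case: eqP => [-> noS|//].
  rewrite (_ : [set b | S b t] = set0) ?first_index_set0 //.
  by rewrite -subset0 => b Sb; apply: noS; exists b.
apply: measurableU.
  by apply: measurableD => //; apply: bigcup_measurable.
rewrite /none; case: ifP => // _.
by apply: measurableC; apply: bigcupT_measurable.
Qed.

Lemma measurable_fun_nat d (T : measurableType d) (f : T -> nat) :
  (forall a, measurable [set t | f t = a]) -> measurable_fun setT f.
Proof.
move=> mf _ Y _; rewrite setTI.
have -> : f @^-1` Y = \bigcup_(a in Y) [set t | f t = a].
  by apply/seteqP; split=> [t Yt|t [a Ya]]; [exists (f t)|move=> /= ->].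
exact: bigcup_measurable.
Qed.

Lemma measurable_column n : measurable_fun setT (column n : baire -> baire).
Proof.
apply: measurable_fun_baire => m a.
exact: (@measurable_coord (pickle (n, m)) [set b | b = a]).
Qed.

(** Pairing by columns 0 and 1 pulls [A] back to a Borel, hence analytic, subset of a single Baire
    space, where the projection becomes the continuous map [column 0]. *)
Lemma projection_analytic (A : set (baire * baire)) : measurable A ->
  analytic [set x | exists y, A (x, y)].
Proof.
move=> mA; have mp : measurable_fun setT
    (fun z : baire => (column 0 z : baire, column 1 z : baire)).
  by apply: measurable_fun_pair; exact: measurable_column.
have := mp measurableT _ mA; rewrite setTI => /measurable_analytic aA.
have := image_analytic (@column_continuous 0) aA; congr (analytic _).
apply/seteqP; split=> [_ [z Az <-]|x [y Axy]]; first by exists (column 1 z).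
exists (merge_columns (fun n => if n is 0 then x else y)).
  by rewrite /= !column_merge.
by rewrite column_merge.
Qed.

(** The bound [n] on the size of sections in pigeonhole form: any [n.+1] listed points of a section
    contain a repetition. *)
Definition sections_le n (A : set (baire * baire)) :=
  forall x (f : nat -> baire), (forall i, (i <= n)%N -> A (x, f i)) ->
    exists i j, [/\ (i < j)%N, (j <= n)%N & f i = f j].

Definition meets_cylinders (A : set (baire * baire)) (l : seq (seq nat)) :
  set baire := [set x | forall i, (i < size l)%N ->
    exists2 y, cylinder (nth [::] l i) y & A (x, y)].

(** Distinct words of a common length have pairwise disjoint cylinders. *)
Definition separating_list n (l : seq (seq nat)) :=
  [/\ uniq l, size l = n & exists N, forall s, s \in l -> size s = N].

Lemma meets_cylinders_unique n (A : set (baire * baire)) l x k y z :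
  sections_le n A -> separating_list n l -> meets_cylinders A l x ->
  (k < n)%N -> cylinder (nth [::] l k) y -> A (x, y) ->
  cylinder (nth [::] l k) z -> A (x, z) -> y = z.
Proof.
move=> An [ul sl [N lN]] Qx kn yk Axy zk Axz.
have /choice[w Hw] : forall i, exists w, (i < n)%N ->
    cylinder (nth [::] l i) w /\ A (x, w).
  move=> i; case: (ltnP i n) => [|_]; last by exists point.
  by rewrite -sl => /Qx[w ? ?]; exists w.
have cyl_inj i j u : (i < n)%N -> (j < n)%N -> cylinder (nth [::] l i) u ->
    cylinder (nth [::] l j) u -> i = j.
  move=> ni nj; rewrite /cylinder /= !lN ?mem_nth ?sl // => -> /eqP.
  by rewrite nth_uniq ?sl // => /eqP.
(* One section point per cylinder, with [y] in the [k]-th, and [z] appended at index [n]. By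
   disjointness a repetition can only be between [z] and the entry [y]. *)
pose f i := if i == n then z else if i == k then y else w i.
have fcyl i : (i < n)%N -> cylinder (nth [::] l i) (f i).
  rewrite /f => ni; case: eqP => [ein|_]; first by rewrite ein ltnn in ni.
  by case: eqP => [->//|_]; case: (Hw i ni).
have fA i : (i <= n)%N -> A (x, f i).
  rewrite leq_eqVlt /f; case: eqP => //= _ ni.
  by case: eqP => // _; case: (Hw i ni).
have [i [j [ij jn fij]]] := An x f fA.
have ni := leq_trans ij jn; have fi := fcyl i ni.
move: jn; rewrite leq_eqVlt => /orP[/eqP ejn|nj]; last first.
  have fj := fcyl j nj; rewrite -fij in fj.
  by have eij := cyl_inj _ _ _ ni nj fi fj; rewrite eij ltnn in ij.
have fz : f i = z by rewrite fij /f ejn eqxx.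
have eik : i = k by apply: (cyl_inj _ _ _ ni kn fi); rewrite fz.
by rewrite -fz /f eik eqxx; case: eqP => // ekn; rewrite ekn ltnn in kn.
Qed.

(* Over meets_cylinders A l the section has exactly one point in each cylinder,
   and separating the analytic sets on which the m-th coordinate of that point
   is, respectively is not, a yields a Borel function computing it. *)
Lemma measurable_meets_cylinders n (A : set (baire * baire)) l :
  measurable A -> sections_le n A -> separating_list n l ->
  measurable (meets_cylinders A l).
Proof.
move=> mA An sepl; have sl : size l = n by case: sepl.
set Q := meets_cylinders A l.
pose Acyl i := A `&` [set p : baire * baire | cylinder (nth [::] l i) p.2].
have mAcyl i : measurable (Acyl i).
  apply: measurableI => //; rewrite -[X in measurable X]setTI.
  exact: (@measurable_snd _ _ baire baire) (@measurable_cylinder _).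
have mAcylP i m (P : set nat) :
    measurable (Acyl i `&` [set p : baire * baire | P (p.2 m)]).
  apply: measurableI => //; rewrite -[X in measurable X]setTI.
  exact: (@measurable_snd _ _ baire baire) (@measurable_coord _ _).
have aQ : analytic Q.
  rewrite (_ : Q = \bigcap_i [set x | (i < size l)%N -> exists y, Acyl i (x, y)]).
    apply: bigcap_analytic => i; case: (ltnP i (size l)) => [il|].
      have -> : [set x | true -> exists y, Acyl i (x, y)] =
          [set x | exists y, Acyl i (x, y)].
        by apply/seteqP; split=> x /= Hx; [exact: Hx|].
      exact: projection_analytic.
    move=> _; rewrite (_ : [set x | _] = setT); first exact: closed_analytic.
    by apply/seteqP.
  apply/seteqP; split=> [x Qx i _ il|x Qx i il].
    by have [y ? ?] := Qx i il; exists y.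
  by have [y []] := Qx i I il; exists y.
have /choice[B HB] : forall ima : nat * nat * nat, exists B : set baire,
    (ima.1.1 < n)%N -> [/\ measurable B,
    forall x y, Q x -> Acyl ima.1.1 (x, y) -> y ima.1.2 = ima.2 -> B x &
    forall x y, Q x -> Acyl ima.1.1 (x, y) -> y ima.1.2 <> ima.2 -> ~ B x].
  move=> [[i m] a] /=; case: (ltnP i n) => [ni|_]; last by exists set0.
  have aP P := setI_analytic aQ (projection_analytic (mAcylP i m P)).
  have [] := analytic_separation (aP [set b | b = a]) (aP [set b | b <> a]).
    rewrite -subset0 => x [[Qx [y [[Axy yl] ya]]] [_ [z [[Axz zl] za]]]].
    apply: za; rewrite /= in ya yl zl *.
    by rewrite -(meets_cylinders_unique An sepl Qx ni yl Axy zl Axz).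
  move=> B [mB QB BQ]; exists B => _; split=> // x y Qx Axy ya.
    by apply: QB; split => //; exists y.
  move=> Bx; have : set0 x; last by [].
  by rewrite -BQ; split => //; split => //; exists y.
(* For [x] in [Q], the only [a] with [B (i, m, a) x] is the [m]-th coordinate of the section point
   in the [i]-th cylinder. *)
pose f i (x : baire) : baire := fun m => first_index [set a | B (i, m, a) x].
have mf i : (i < n)%N -> measurable_fun setT (f i).
  move=> ni; apply: measurable_fun_baire => m a.
  by apply: measurable_first_index => b; case: (HB (i, m, b) ni).
have fE i x y : (i < n)%N -> Q x -> Acyl i (x, y) -> f i x = y.
  move=> ni Qx Axy; apply/funext => m.
  have nB b : y m <> b -> ~ B (i, m, b) x.
    by move=> yb; case: (HB (i, m, b) ni) => _ _ /(_ x y Qx Axy); apply.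
  apply: first_index_eq.
    by case: (HB (i, m, y m) ni) => _ /(_ x y Qx Axy erefl).
  by move=> b byx; apply: nB => yb; rewrite yb ltnn in byx.
(* Off [Q] the values of [f i] are arbitrary, but passing the test on the right exhibits a section
   point in every cylinder and so forces membership in [Q]. *)
have -> : Q = \bigcap_(i in [set i | (i < n)%N]) [set x | Acyl i (x, f i x)].
  apply/seteqP; split=> [x Qx i /= ni|x Hx i]; last first.
    by rewrite sl => ni; have [] := Hx i ni; exists (f i x).
  have [y yl Axy] : exists2 y, cylinder (nth [::] l i) y & A (x, y).
    by apply: Qx; rewrite sl.
  by rewrite (fE i x y).
apply: bigcap_measurableType => i ni; rewrite -[X in measurable X]setTI.
have mp : measurable_fun setT (fun x : baire => (x, f i x)).
  by apply: measurable_fun_pair => //; exact: mf.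
exact: (mp measurableT _ (mAcyl i)).
Qed.

(* The case of finite sections of bounded size of the Lusin-Novikov theorem. *)
Theorem measurable_projection n (A : set (baire * baire)) :
  measurable A -> sections_le n A -> measurable [set x | exists y, A (x, y)].
Proof.
elim: n A => [|n IH] A mA An.
  rewrite (_ : [set x | _] = set0) // -subset0 => x [y Axy].
  have [|i [j [+ + _]]] := An x (fun=> y); first by move=> i _.
  by rewrite leqn0 => + /eqP j0; rewrite j0.
(* There are only countably many lists of words, and [X] collects the points whose section has the
   full [n.+1] elements. *)
pose X := \bigcup_l [set x | separating_list n.+1 l /\ meets_cylinders A l x].
have mX : measurable X.
  apply: countable_bigcupT_measurable => // l.
  have [sepl|nsep] := pselect (separating_list n.+1 l); last first.
    by rewrite (_ : [set x | _] = set0) // -subset0 => x [].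
  rewrite (_ : [set x | _] = meets_cylinders A l).
    exact: (measurable_meets_cylinders mA An).
  by apply/seteqP; split=> [x []|].
pose A' := A `&` [set p : baire * baire | ~ X p.1].
have mA' : measurable A'.
  apply: measurableI => //; rewrite -[X in measurable X]setTI.
  exact: (@measurable_fst _ _ baire baire) measurableT _ (measurableC mX).
have A'n : sections_le n A'.
  move=> x f fA'; apply: contrapT => ninj.
  have fneq i j : (i < j)%N -> (j <= n)%N -> f i <> f j.
    by move=> ij jn fij; apply: ninj; exists i, j.
  have /choice[D HD] : forall ij : nat * nat, exists m,
      (ij.1 < ij.2)%N -> (ij.2 <= n)%N -> f ij.1 m <> f ij.2 m.
    move=> [i j] /=; case: (ltnP i j) => [ij|_]; last by exists 0%N.
    case: (leqP j n) => [jn|_]; last by exists 0%N.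
    apply: contrapT => /forallNP nex; apply: (fneq _ _ ij jn); apply/funext => m.
    by apply: contrapT => fm; apply: (nex m).
  (* Prefixes of length [N] reach past every chosen coordinate of difference, so they separate all
     the points [f i] at once. *)
  pose N := (\max_(p : 'I_n.+1 * 'I_n.+1) D (val p.1, val p.2)).+1.
  have mkneq i j : (i < j)%N -> (j <= n)%N -> mkseq (f i) N <> mkseq (f j) N.
    move=> ij jn /agree_mkseq fij; apply: (HD (i, j)) => //=; apply: fij.
    have ni : (i < n.+1)%N by apply: leq_trans ij _; apply: leq_trans jn _.
    rewrite ltnS; exact: (@leq_bigmax _ _ (Ordinal ni, Ordinal (jn : j < n.+1)%N)).
  have [_ nX] := fA' 0%N (leq0n n); apply: nX => /=.
  exists (mkseq (fun i => mkseq (f i) N) n.+1) => //; split.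
    split; [|by rewrite size_mkseq|].
      apply/mkseq_uniqP => i j; rewrite !inE !ltnS => ni nj fij.
      by case: (ltngtP i j) => // [/mkneq|/mkneq] H; exfalso; exact: H.
    by exists N => s /mapP[i _ ->]; exact: size_mkseq.
  move=> i; rewrite size_mkseq => ni; exists (f i).
    by rewrite nth_mkseq //; apply/cylinder_mkseq.
  by case: (fA' i ni).
rewrite (_ : [set x | _] = X `|` [set x | exists y, A' (x, y)]).
  by apply: measurableU => //; exact: IH.
apply/seteqP; split=> x.
  move=> [y Axy]; have [|nX] := pselect (X x); first by left.
  by right; exists y.
case=> [[l _ [[_ sl _] Qx]]|[y []]]; last by exists y.
by have [|y _ Axy] := Qx 0%N; [rewrite sl|exists y].
Qed.

(** * Standard Borel spaces as retracts of the Baire space *)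

Definition natSinv (R : realType) (m : nat) : R := m.+1%:R^-1.

Section polish_coding.
Context (R : realType) (P : metricType R).
Implicit Types (p q : P) (u : nat -> P).

(** The fixed rate turns convergence into countably many conditions on coordinates. *)
Definition fast_limit u p := forall m, mdist (u m) p <= natSinv R m.

Lemma exists_natSinv_lt (e : R) : 0 < e ->
  exists N, forall m, (N <= m)%N -> natSinv R m < e.
Proof.
by move=> e0; have [N _ HN] := near_infty_natSinv_lt (PosNum e0); exists N.
Qed.

Lemma metric_ball_open p (e : R) : open (ball p e).
Proof.
rewrite openE => q; rewrite ballEmdist /= => pq; apply/nbhs_ballP.
exists (e - mdist p q); rewrite /= ?subr_gt0 // => z; rewrite ballEmdist /=.
rewrite ltrBrDl; apply: le_lt_trans; exact: metric_triangle.
Qed.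

Lemma fast_limit_unique u p q : fast_limit u p -> fast_limit u q -> p = q.
Proof.
move=> up uq; apply: mdist_positivity; apply/eqP.
rewrite eq_le mdist_ge0 andbT leNgt; apply/negP => pq.
have [N HN] := exists_natSinv_lt (divr_gt0 pq (@ltr0n R 2)).
have := HN N (leqnn N); have := up N; have := uq N.
have := metric_triangle p (u N) q; rewrite (metric_sym p (u N)).
by move=> *; lra.
Qed.

(** The hypothesis makes [u] Cauchy, and letting [k] tend to infinity in it gives the required rate.
    It involves two coordinates at a time, so the convergent codes will form a Borel set. *)
Lemma fast_limit_exists u : complete_metric P ->
  (forall m k, mdist (u m) (u k) <= natSinv R m + natSinv R k) ->
  exists p, fast_limit u p.
Proof.
move=> cP u_cauchy.
have [] := cP (u @ \oo).
  apply: cauchy_exP => e e0; have e20 : 0 < e / 2 by rewrite divr_gt0.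
  have [N HN] := exists_natSinv_lt e20; exists (u N); exists N => // m /= Nm.
  rewrite ballEmdist /=; have := u_cauchy N m.
  have := HN N (leqnn N); have := HN m Nm => *; lra.
move=> p /fcvg_ballP up; exists p => m; apply/ler_addgt0Pl => e e0.
have e20 : 0 < e / 2 by rewrite divr_gt0.
have [N HN] := exists_natSinv_lt e20.
have [K _ HK] := up _ e20.
have := HK (maxn N K) (leq_maxr _ _); rewrite ballEmdist /= metric_sym.
have := HN (maxn N K) (leq_maxl _ _); have := u_cauchy m (maxn N K).
have := metric_triangle (u m) (u (maxn N K)) p => *; lra.
Qed.

(** The closed balls around [u N] all contain [p] and have radii tending to 0. This tests the limit
    through single coordinates of [u]. *)
Lemma fast_limit_open u p (U : set P) : fast_limit u p -> open U ->
  U p <-> exists N, [set q | mdist (u N) q <= natSinv R N] `<=` U.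
Proof.
move=> up oU; split=> [Up|[N]]; last by apply; exact: up.
have /nbhs_ballP[e /= e0 eU] := open_nbhs_nbhs (conj oU Up).
have e20 : 0 < e / 2 by rewrite divr_gt0.
have [N HN] := exists_natSinv_lt e20; exists N => q /= uq.
apply: eU; rewrite ballEmdist /=; have := HN N (leqnn N); have := up N.
have := metric_triangle p (u N) q; rewrite (metric_sym p (u N)) => *; lra.
Qed.

Lemma separable_enumeration p : separable_space P ->
  exists s : nat -> P, forall q (e : R), 0 < e -> exists k, mdist (s k) q < e.
Proof.
move=> [S /countable_injP[h hinj] dS].
exists (fun k => xget p [set x | S x /\ h x = k]) => q e e0.
have [|x [qx Sx]] := dS (ball q e) _ (@metric_ball_open _ _).
  by exists q; rewrite ballEmdist /= mdistxx.
exists (h x); rewrite (@xget_unique _ _ _ x) //.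
  by move: qx; rewrite ballEmdist /= metric_sym.
by move=> y [Sy hxy]; apply: hinj => //; rewrite inE.
Qed.

End polish_coding.

Lemma measurable_coord2 m k (P : nat -> nat -> Prop) :
  measurable [set x : baire | P (x m) (x k)].
Proof.
rewrite (_ : [set x | _] = \bigcup_a ([set x : baire | x m = a] `&`
    [set x : baire | P a (x k)])); last first.
  by apply/seteqP; split=> [x Px|x [a _ [/= -> //]]]; exists (x m).
apply: bigcupT_measurable => a.
apply: measurableI; last exact: (@measurable_coord k (P a)).
exact: (@measurable_coord m [set b | b = a]).
Qed.

(** The code of [v] lists, for each [m], the first point of a dense sequence within [natSinv R m] of
    it; decoding takes the limit, with a default value on codes that do not converge. *)
Lemma standard_borel_retract (R : realType) d (V : measurableType d) :
  standard_borel R V -> exists (e : V -> baire) (r : baire -> V),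
    [/\ measurable_fun setT e, measurable_fun setT r & cancel e r].
Proof.
move=> [P [cP sP [f bf fP]]]; have finj := bij_inj bf.
have [s Hs] := separable_enumeration (f point) sP.
pose e v : baire := fun m => first_index [set k | mdist (s k) (f v) < natSinv R m].
pose r (x : baire) := xget point [set v | fast_limit (s \o x) (f v)].
have rE x v : fast_limit (s \o x) (f v) -> r x = v.
  move=> xv; apply: xget_unique => // w xw; apply: finj.
  exact: fast_limit_unique xw xv.
pose C := [set x : baire | exists p, fast_limit (s \o x) p].
have mC : measurable C.
  rewrite (_ : C = \bigcap_m \bigcap_k [set x : baire |
      mdist (s (x m)) (s (x k)) <= natSinv R m + natSinv R k]); last first.
    apply/seteqP; split=> [x [p xp] m _ k _|x xC] /=.
      have := xp m; have := xp k; rewrite /= (metric_sym (s (x k))).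
      have := metric_triangle (s (x m)) p (s (x k)) => *; lra.
    by apply: fast_limit_exists => // m k; exact: (xC m I k I).
  apply: bigcap_measurableType => m _; apply: bigcap_measurableType => k _.
  exact: (@measurable_coord2 m k
    (fun a b => mdist (s a) (s b) <= natSinv R m + natSinv R k)).
exists e, r; split.
- apply: measurable_fun_baire => m a; apply: measurable_first_index => k.
  rewrite [X in measurable X](_ : _ = f @^-1` ball (s k) (natSinv R m)); last first.
    by rewrite ballEmdist.
  by apply/fP; apply: sub_sigma_algebra; exact: metric_ball_open.
- move=> _ Y mY; rewrite setTI.
  (* [Y] is the preimage of a Borel set of [P], so it is enough to treat the generating open
     sets. *)
  have YE : Y = f @^-1` (f @` Y).
    by apply/seteqP; split=> [v Yv|v [w Yw /finj <-]] //; exists v.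
  rewrite YE -comp_preimage.
  have : <<s [set U : set P | open U] >> (f @` Y) by apply/fP; rewrite -YE.
  move: (f @` Y); apply: smallest_sub.
    split=> [|B mB|B mB] /=; first by rewrite preimage_set0.
      by rewrite setTD preimage_setC; exact: measurableC.
    by rewrite preimage_bigcup; exact: bigcupT_measurable.
  move=> U /= oU.
  (* On [C] the limit is in [U] iff one of the closed balls given by the code is inside [U]; off [C]
     the map [r] is constantly [point]. *)
  have -> : (f \o r) @^-1` U = (C `&` \bigcup_N [set x : baire |
      [set q | mdist (s (x N)) q <= natSinv R N] `<=` U]) `|`
      (~` C `&` [set _ | U (f point)]).
    have rC x : C x -> fast_limit (s \o x) (f (r x)).
      move=> [p xp]; have [g fg gf] := bf.
      by rewrite (rE x (g p)) ?gf //; rewrite gf.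
    have rNC x : ~ C x -> r x = point.
      by move=> nC; apply: xgetPN => v xv; apply: nC; exists (f v).
    apply/seteqP; split=> x /=.
      have [Cx Ux|nCx] := pselect (C x); last by rewrite rNC //; right.
      by left; split => //; have [N NU] := (fast_limit_open (rC x Cx) oU).1 Ux;
        exists N.
    case=> [[Cx [N _ NU]]|[nCx Up]]; last by rewrite rNC.
    by apply/(fast_limit_open (rC x Cx) oU); exists N.
  apply: measurableU; apply: measurableI => //.
  + apply: bigcupT_measurable => N.
    exact: (@measurable_coord N
      [set k | [set q | mdist (s k) q <= natSinv R N] `<=` U]).
  + exact: measurableC.
  + have [Up|nUp] := pselect (U (f point)).
      by have -> : [set _ : baire | U (f point)] = setT by apply/seteqP; split.
    by have -> : [set _ : baire | U (f point)] = set0 by rewrite -subset0.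
- move=> v; apply: rE => m; apply: ltW.
  have m0 : 0 < natSinv R m by rewrite invr_gt0.
  by have [k Hk] := Hs (f v) _ m0; have [] := first_indexP
    (ex_intro _ k Hk : [set k | mdist (s k) (f v) < natSinv R m] !=set0).
Qed.

(** The relation is decoded through [r] on both sides, projected in the Baire space, and the result
    is pulled back along [e]. *)
Lemma measurable_in_neighbours (R : realType) d (V : measurableType d)
    (A : set (V * V)) n (B : set V) :
  standard_borel R V -> measurable A ->
  (forall x, (out_neighbours A x #<= `I_n)%card) -> measurable B ->
  measurable [set x | exists2 y, B y & A (x, y)].
Proof.
move=> /standard_borel_retract[e [r [me mr er]]] mA An mB.
have mfix : measurable [set y : baire | e (r y) = y].
  rewrite (_ : [set y | _] = \bigcap_m \bigcup_a
      ((e \o r) @^-1` [set y : baire | y m = a] `&` [set y : baire | y m = a])).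
    apply: bigcap_measurableType => m _; apply: bigcupT_measurable => a.
    apply: measurableI; last exact: (@measurable_coord m [set b | b = a]).
    rewrite -[X in measurable X]setTI; apply: measurableT_comp => //.
    exact: (@measurable_coord m [set b | b = a]).
  apply/seteqP; split=> [y /= yE m _|y /= yE].
    by exists (y m) => //; rewrite /= yE.
  by apply/funext => m; have [a _ [/= -> ->]] := yE m I.
(* Keeping only canonical codes, those fixed by [e \o r], gives each out-neighbour a single code, so
   that sections keep at most [n] points. *)
pose A' := [set p : baire * baire | [/\ e (r p.2) = p.2, B (r p.2) &
  A (r p.1, r p.2)]].
have mA' : measurable A'.
  rewrite (_ : A' = snd @^-1` ([set y : baire | e (r y) = y] `&` r @^-1` B) `&`
    (fun p => (r p.1, r p.2)) @^-1` A); last first.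
    by apply/seteqP; split=> [p [? ? ?]|p [[? ?] ?]].
  apply: measurableI.
    rewrite -[X in measurable X]setTI; apply: measurable_snd => //.
    by apply: measurableI => //; rewrite -[X in measurable X]setTI; exact: mr.
  rewrite -[X in measurable X]setTI.
  have : measurable_fun setT (fun p : baire * baire => (r p.1, r p.2)).
    by apply: measurable_fun_pair; apply: measurableT_comp.
  by apply.
have A'n : sections_le n A'.
  move=> x g gA'; apply: contrapT => ninj.
  have /pcard_leP[h] := An (r x).
  have : (n.+1 <= n)%N; last by rewrite ltnn.
  have gout i : (i <= n)%N -> out_neighbours A (r x) (r (g i)).
    by move=> /gA'[].
  apply: (@pigeonhole _ _ (fun i => h (r (g i)))).
    move=> i j; rewrite !inE /= !ltnS => ni nj.
    move=> /('inj_h (mem_set (gout i ni)) (mem_set (gout j nj))) rgij.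
    have gij : g i = g j.
      have [ei _ _] := gA' i ni; have [ej _ _] := gA' j nj.
      exact: etrans (esym ei) (etrans (congr1 e rgij) ej).
    by case: (ltngtP i j) => // ij; exfalso; apply: ninj;
      [exists i, j|exists j, i].
  by move=> _ [i /= ni <-]; exact: ('funS_h (gout i ni)).
have := me measurableT _ (measurable_projection mA' A'n); rewrite setTI.
congr (measurable _); apply/seteqP; split=> x /=.
  by move=> [y [_ By]]; rewrite /= er => Axy; exists (r y).
by move=> [y By Axy]; exists (e y); rewrite /A' /= !er.
Qed.

(** * Greedy constructions *)

Section greedy.
Context d (V : measurableType d) (A : set (V * V)) (c : V -> nat) (n : nat).
Context (mA : forall B : set V, measurable B ->
  measurable [set x | exists2 y, B y & A (x, y)]).
Context (An : forall x, (out_neighbours A x #<= `I_n)%card).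
Context (mc : measurable_fun setT c).
Context (c_proper : forall x y, underlying A x y -> c x <> c y).

Let mcP (P : set nat) : measurable [set x | P (c x)].
Proof. by rewrite -[X in measurable X]setTI; exact: mc. Qed.

Lemma greedy_dominating k : exists M : set V, [/\ measurable M,
  forall x, (c x < k)%N -> M x \/ exists2 y, M y & A (x, y) &
  forall x y, M x -> M y -> A (x, y) -> (c x < c y)%N].
Proof.
(* The induction also needs that [M] has only colors below [k]: arcs from old to new vertices then
   increase [c]. Arcs from new to old are excluded by the choice of new vertices, arcs between new
   ones by properness. *)
suff [M [? _ ? ?]] : exists M : set V, [/\ measurable M,
    forall x, M x -> (c x < k)%N,
    forall x, (c x < k)%N -> M x \/ exists2 y, M y & A (x, y) &
    forall x y, M x -> M y -> A (x, y) -> (c x < c y)%N] by exists M.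
elim: k => [|k [M [mM Mk Mdom Minc]]]; first by exists set0.
exists (M `|` ([set x | c x = k] `\` [set x | exists2 y, M y & A (x, y)])); split.
- apply: measurableU => //; apply: measurableD; last exact: mA.
  exact: (@mcP [set k]).
- by move=> x [/Mk/ltnW|[/= ->]].
- move=> x; rewrite ltnS leq_eqVlt => /orP[/eqP cx|/Mdom[Mx|[y My Axy]]].
  + have [[y My Axy]|noM] := pselect (exists2 y, M y & A (x, y)).
      by right; exists y => //; left.
    by left; right.
  + by left; left.
  + by right; exists y => //; left.
- move=> x y [Mx|[/= cx nMx]] [My|[/= cy _]] Axy.
  + exact: Minc.
  + by rewrite cy; exact: Mk.
  + by exfalso; apply: nMx; exists y.
  + by exfalso; apply: (@c_proper x y); [left|rewrite cx cy].
Qed.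

Lemma avoid_out_neighbours (g : V -> nat) x :
  exists2 a, (a <= n)%N & forall y, A (x, y) -> g y <> a.
Proof.
apply: contrapT => noa.
have /choice[y Hy] : forall a, exists y, (a <= n)%N -> A (x, y) /\ g y = a.
  move=> a; case: (leqP a n) => an; last by exists point.
  apply: contrapT => noy; apply: noa; exists a => // y Axy gy.
  by apply: noy; exists y.
have /pcard_leP[h] := An x.
have : (n.+1 <= n)%N; last by rewrite ltnn.
have yout a : (a <= n)%N -> out_neighbours A x (y a) by move=> /Hy[].
apply: (@pigeonhole _ _ (h \o y)); last first.
  by move=> _ [a /= an <-]; exact: ('funS_h (yout a an)).
move=> a b; rewrite !inE /= !ltnS => an bn.
move=> /('inj_h (mem_set (yout a an)) (mem_set (yout b bn))) yab.
by have [_ <-] := Hy a an; have [_ <-] := Hy b bn; rewrite yab.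
Qed.

(** Levels of [c] are treated from the top down: arcs inside [M] lead to levels already colored, so
    each vertex takes the least color free among its out-neighbours there. *)
Lemma greedy_coloring k (M : set V) : measurable M ->
  (forall x, (c x < k)%N) ->
  (forall x y, M x -> M y -> A (x, y) -> (c x < c y)%N) ->
  borel_colorable (underlying A) M n.+1.
Proof.
move=> mM ck Minc.
(* The bound [k - k] is 0 in disguise: generalizing only the subtracted [k] to [j] gives the
   invariant that levels from [k - j] up are properly colored. *)
suff [g [mg gn gp]] : exists g : V -> nat, [/\ measurable_fun setT g,
    forall x, (g x <= n)%N & forall x y, M x -> M y -> (k - k <= c x)%N ->
      (k - k <= c y)%N -> A (x, y) -> g x <> g y].
  exists g; split=> [|x Mx|x y Mx My].
  - exact: measurable_funTS.
  - by rewrite ltnS.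
  - rewrite subnn in gp; case=> [Axy|Ayx]; first exact: gp.
    by move/esym; exact: gp.
move: {2 4}k => j; elim: j => [|j [g [mg gn gp]]].
  exists (fun=> 0%N); split => // x y _ _; rewrite subn0 leqNgt.
  by rewrite (ck x).
case: (leqP k j) => [kj|jk].
  exists g; split => // x y Mx My _ _; apply: gp => //;
  by rewrite (_ : k - j = 0)%N //; apply/eqP; rewrite subn_eq0.
have kjE : (k - j = (k - j.+1).+1)%N by rewrite subnSK.
pose used a := [set x | exists2 y, (M `&` [set y | (k - j <= c y)%N] `&`
  [set y | g y = a]) y & A (x, y)].
pose free x := first_index [set a | ~ used a x].
have mused a : measurable (used a).
  apply: mA; apply: measurableI; first by apply: measurableI => //;
    exact: (@mcP [set b | (k - j <= b)%N]).
  by rewrite -[X in measurable X]setTI; exact: (mg measurableT [set a]).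
have [freeP freen] : (forall x, ~ used (free x) x) /\ forall x, (free x <= n)%N.
  have freeP x : ~ used (free x) x /\ (free x <= n)%N.
    have [a an Ha] := avoid_out_neighbours g x.
    have nua : ~ used a x by move=> [y [_ /= gy] /Ha].
    have [fx minf] := first_indexP (ex_intro _ a nua : [set a | ~ used a x] !=set0).
    split=> //; apply: leq_trans an; rewrite leqNgt; apply/negP => fa.
    exact: (minf a fa).
  by split=> x; case: (freeP x).
pose g' x := if c x == (k - j.+1)%N then free x else g x.
exists g'; split.
- apply: measurable_fun_nat => a.
  rewrite (_ : [set x | _] =
      ([set x | c x = (k - j.+1)%N] `&` [set x | free x = a]) `|`
      ([set x | c x <> (k - j.+1)%N] `&` [set x | g x = a])); last first.
    apply/seteqP; split=> x /=; rewrite /g'; case: eqP => cx.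
    + by left.
    + by right.
    + by case=> -[].
    + by case=> -[].
  apply: measurableU; apply: measurableI.
  + exact: (@mcP [set b | b = (k - j.+1)%N]).
  + by apply: measurable_first_index => b; exact: measurableC.
  + exact: (@mcP [set b | b <> (k - j.+1)%N]).
  + by rewrite -[X in measurable X]setTI; exact: (mg measurableT [set a]).
- by move=> x; rewrite /g'; case: ifP.
(* The head [y] lies strictly above the level being recolored, so it keeps its color; only the tail
   [x] may have changed. *)
- move=> x y Mx My cx cy Axy; have cxy := Minc x y Mx My Axy.
  have cyj : (k - j <= c y)%N by rewrite kjE (leq_ltn_trans cx).
  have cyN : (c y == (k - j.+1)%N) = false by rewrite gtn_eqF // -kjE.
  rewrite /g' cyN; case: eqP => [ecx fxy|/eqP necx].
    by apply: (freeP x); exists y.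
  by apply: gp => //; rewrite kjE ltn_neqAle eq_sym necx.
Qed.

End greedy.

(** * Directed distance to [M] and conclusion *)

Lemma ddist_set_le1 (R : realType) d (V : measurableType d) (A : set (V * V))
    (M : set V) x : (forall x, ~ A (x, x)) ->
  M x \/ (exists2 y, M y & A (x, y)) -> (ddist_set R A x M <= 1)%E.
Proof.
move=> irr [Mx|[y My Axy]].
  apply: (@le_trans _ _ (ddist R A x x)); first by apply: ereal_inf_lbound; exists x.
  apply: (@le_trans _ _ 0%E); last exact: lee01.
  by apply: ereal_inf_lbound; exists [::].
apply: (@le_trans _ _ (ddist R A x y)); first by apply: ereal_inf_lbound; exists y.
apply: ereal_inf_lbound; exists [:: y] => //; split=> //=.
  by rewrite andbT; apply/asboolP.
(* Directed paths have no repeated vertex, so a one-arc path requires irreflexivity. *)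
by rewrite andbT inE; apply/eqP => xy; apply: (irr x); rewrite {2}xy.
Qed.

Theorem theorem4p1 (R : realType) (d : measure_display) (V : measurableType d)
    (A : set (V * V)) (n : nat)
    (n_ge1 : (1 <= n)%N)
    (V_std : standard_borel R V)
    (A_irr : forall x : V, ~ A (x, x))
    (A_borel : measurable A)
    (A_lc : locally_countable A)
    (A_chi : (borel_chromatic R (underlying A) [set: V] < +oo)%E)
    (A_out : forall x : V, (out_neighbours A x #<= `I_n)%card) :
  exists M : set V,
    [/\ measurable M,
        (borel_chromatic R (underlying A) M <= (n.+1%:R)%:E)%E &
        forall x : V, (ddist_set R A x M <= 1)%E].
Proof.
have mA B (mB : measurable B) := measurable_in_neighbours V_std A_borel A_out mB.
have [_ [k [c [mc ck cp]] _] _] := ereal_inf_lt A_chi.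
have c_proper x y : underlying A x y -> c x <> c y by exact: cp.
have [M [mM Mdom Minc]] := greedy_dominating mA mc c_proper k.
exists M; split=> //.
  apply: ereal_inf_lbound; exists n.+1 => //.
  by apply: (greedy_coloring mA A_out mc mM _ Minc) => x; exact: ck.
by move=> x; apply: ddist_set_le1 => //; apply: Mdom; exact: ck.
Qed.
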